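(* Let $\tilde F_k$ ($k\ge 1$) be the (re-indexed) even-indexed stable cluster variables of the framed $F_0$ quiver with mutation sequence $(0,1,2,3,0,1,2,3,\ldots)$, as defined in the context. Then $\lim_{k\to\infty}\tilde F_k$ converges as a formal power series in $y_0,y_1,y_2,y_3$; that is, for every monomial in $y_0,y_1,y_2,y_3$, its coefficient in $\tilde F_k$ is constant for all sufficiently large $k$.
   Context: Quiver mutation. A quiver is a finite directed graph, possibly with multiple edges, without self-loops or 2-cycles; each vertex $v$ carries a label $\ell_v$. Mutation at a vertex $v$: (1) replace the label $\ell_v$ by $\bigl(\prod_{\text{arrows } u\to v}\ell_u+\prod_{\text{arrows } v\to u}\ell_u\bigr)/\ell_v$ (products over arrows with multiplicity, using the arrows before mutation); (2) for every 2-path $u\to v\to w$ add an arrow $u\to w$; (3) delete newly created self-loops and cancel newly created 2-cycles in pairs; (4) reverse all arrows incident to $v$. Framed $F_0$ quiver: vertices $0,1,2,3$ and frozen vertices $0',1',2',3'$ (never mutated); arrows: two arrows each $2\to 0$, $1\to 2$, $3\to 1$, $0\to 3$, and one arrow $i\to i'$ for each $i=0,1,2,3$. Initial labels: $1$ at each vertex $i$, and $y_i$ at each $i'$. Mutate successively at $0,1,2,3,0,1,2,3,\ldots$. Let $G_n$ be the new label produced at the $n$-th mutation (the $n$-th F-polynomial, a polynomial in $y_0,\dots,y_3$), and let $D_n$ be the $4\times 4$ matrix whose $(i,j)$ entry is the number of arrows $i'\to j$ in the quiver after $n$ mutations (negative if the arrows point $j\to i'$). Only even-indexed F-polynomials are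 considered, re-indexed as $F_k:=G_{2k}$, with $C_k:=D_{2k}$. The $C_k$-matrix transformation sends a monomial $y^{\vec a}$ to $y^{\vec b}$ with $\vec b=C_k^{-1}\vec a$, extended linearly; $\tilde F_k$ is the image of $F_k$. Convention on parity: for odd $k$, this transformation replaces $y_0^{a_0}y_1^{a_1}y_2^{a_2}y_3^{a_3}$ by $$y_0^{ka_0-(k+1)a_2}\;y_1^{ka_1-(k+1)a_3}\;y_2^{(k-1)a_0-ka_2}\;y_3^{(k-1)a_1-ka_3},$$ while for even $k$ the result is the same after interchanging $y_0\leftrightarrow y_2$ and $y_1\leftrightarrow y_3$. To remove this alternation, the displayed (odd) form is used for all $k\ge 1$ to define $\tilde F_k$. *)

(* Defs.v *)
From mathcomp Require Import all_boot all_order all_algebra.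
From mathcomp Require Import fraction zify ring mpoly.

Set Implicit Arguments.
Unset Strict Implicit.
Unset Printing Implicit Defensive.

Import Order.TTheory GRing.Theory Num.Theory.
Local Open Scope ring_scope.

(* [inl i] is the mutable vertex i, [inr i] the frozen vertex i'. *)
Definition vertex : finType := ('I_4 + 'I_4)%type.

(* [Q u v] is the number of arrows u -> v. *)
Definition quiver := vertex -> vertex -> nat.

Definition labelling := vertex -> {fraction {mpoly int[4]}}.

Definition add_two_paths (v : vertex) (Q : quiver) : quiver :=
  fun u w => (Q u w + Q u v * Q v w)%N.

(* On nat the subtraction is truncated, so the smaller of the two opposite
   multiplicities is cancelled from both. *)
Definition cancel_cycles (Q : quiver) : quiver :=
  fun u w => if u == w then 0%N else (Q u w - Q w u)%N.

Definition reverse_at (v : vertex) (Q : quiver) : quiver :=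
  fun u w => if (u == v) || (w == v) then Q w u else Q u w.

Definition mutate_quiver (v : vertex) (Q : quiver) : quiver :=
  reverse_at v (cancel_cycles (add_two_paths v Q)).

Definition mutate_labels (v : vertex) (Q : quiver) (l : labelling) : labelling :=
  fun w => if w == v
           then (\prod_u l u ^+ Q u v + \prod_u l u ^+ Q v u) / l v
           else l w.

Definition F0_arrows (i j : nat) : nat :=
  match i, j with
  | 2, 0 | 1, 2 | 3, 1 | 0, 3 => 2
  | _, _ => 0
  end%N.

Definition framed_F0 : quiver := fun u v =>
  match u, v with
  | inl i, inl j => F0_arrows i j
  | inl i, inr j => (i == j : nat)
  | _, _ => 0%N
  end.

Definition initial_labels : labelling := fun u =>
  match u with
  | inl _ => 1
  | inr i => tofrac 'X_i
  end.

(* The vertex mutated by the (n+1)-st mutation, i.e. n mod 4. *)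
Definition mutated (n : nat) : vertex := inl (inZp n).

Fixpoint seed (n : nat) : quiver * labelling :=
  if n is m.+1 then
    let: (Q, l) := seed m in
    (mutate_quiver (mutated m) Q, mutate_labels (mutated m) Q l)
  else (framed_F0, initial_labels).

(* Meaningful for 0 < n. *)
Definition G (n : nat) : {fraction {mpoly int[4]}} :=
  (seed n).2 (mutated n.-1).

Definition D (n : nat) : 'M[int]_4 :=
  \matrix_(i, j) (((seed n).1 (inr i) (inl j))%:Z
                  - ((seed n).1 (inl j) (inr i))%:Z).

Definition C (k : nat) : 'M[int]_4 := D k.*2.

(* Exponent vectors of Laurent monomials in y_0, ..., y_3. *)
Definition exponent := 'cV[int]_4.

Definition exponent_of (a : 'X_{1..4}) : exponent := \col_i (a i)%:Z.

(* The C_k-matrix transformation of y^a in its odd form; it is C_k^-1 *m a for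
   odd k, and C_k^-1 *m a up to y_0 <-> y_2, y_1 <-> y_3 for even k: see
   [stable_exponentE]. *)
Definition stable_exponent (k : nat) (a : 'X_{1..4}) : exponent :=
  \col_i
    match val i with
    | 0%N => k%:Z * (a 0)%:Z - (k.+1)%:Z * (a 2)%:Z
    | 1%N => k%:Z * (a 1)%:Z - (k.+1)%:Z * (a 3)%:Z
    | 2%N => (k%:Z - 1) * (a 0)%:Z - k%:Z * (a 2)%:Z
    | _   => (k%:Z - 1) * (a 1)%:Z - k%:Z * (a 3)%:Z
    end.

(* The exchange y_0 <-> y_2, y_1 <-> y_3. *)
Definition swap_exponent (e : exponent) : exponent := \col_i e (i + 2) 0.

(* The coefficient of y^e in the Laurent polynomial that is the image of p
   under the linear extension of y^a |-> y^(stable_exponent k a). *)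
Definition stable_coef (k : nat) (p : {mpoly int[4]}) (e : exponent) : int :=
  \sum_(a <- msupp p | stable_exponent k a == e) p@_a.

Definition power_series := 'X_{1..4} -> int.

Definition series_coef (S : power_series) (e : exponent) : int :=
  if [forall i, 0 <= e i 0] then S [multinom absz (e i 0)%R | i < 4] else 0.

(* Laurent polynomials, given by their coefficients, converge coefficientwise
   to a formal power series (no negative exponents in the limit). *)
Definition converges_as_power_series (T : nat -> exponent -> int) : Prop :=
  exists S : power_series, forall e : exponent,
    exists K : nat, forall k : nat, (K <= k)%N -> T k e = series_coef S e.

Lemma mutate_quiverE v Q u w : mutate_quiver v Q u w =
  (if (u == v) || (w == v) then
     if w == u then 0 else (Q w u + Q w v * Q v u) - (Q u w + Q u v * Q v w)
   else
     if u == w then 0 else (Q u w + Q u v * Q v w) - (Q w u + Q w v * Q v u))%N.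
Proof. by []. Qed.

(* Q has mutable part A and p.1 (resp. p.2) arrows i' -> j (resp. j -> i')
   for p = P i j. *)
Definition has_arrows (A : nat -> nat -> nat) (P : nat -> nat -> nat * nat)
    (Q : quiver) : Prop :=
  forall i j : 'I_4, [/\ Q (inl i) (inl j) = A i j,
    Q (inr i) (inl j) = (P i j).1 & Q (inl j) (inr i) = (P i j).2].

Definition odd_arrows (i j : nat) : nat :=
  match i, j with 0, 2 | 2, 1 | 1, 3 | 3, 0 => 2 | _, _ => 0 end%N.

Definition even_frozen (k i j : nat) : nat * nat :=
  match i, j with
  | 0, 0 | 1, 1 => (0, k.+1)
  | 0, 2 | 1, 3 => (k, 0)
  | 2, 0 | 3, 1 => (0, k)
  | 2, 2 | 3, 3 => (k.-1, 1 - k)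
  | _, _ => (0, 0)
  end%N.

Definition odd_frozen (k i j : nat) : nat * nat :=
  match i, j with
  | 0, 0 | 1, 1 => (k, 0)
  | 0, 2 | 1, 3 => (0, k.+1)
  | 2, 0 | 3, 1 => (k.-1, 0)
  | 2, 2 | 3, 3 => (0, k)
  | _, _ => (0, 0)
  end%N.

Lemma has_arrows_even k Q : has_arrows F0_arrows (even_frozen k) Q ->
  has_arrows odd_arrows (odd_frozen k.+1)
    (mutate_quiver (mutated 1) (mutate_quiver (mutated 0) Q)).
Proof.
move=> h i j.
have hA a b : Q (inl a) (inl b) = F0_arrows a b by case: (h a b).
have hP a b : Q (inr a) (inl b) = (even_frozen k a b).1 by case: (h a b).
have hN a b : Q (inl b) (inr a) = (even_frozen k a b).2 by case: (h a b).
rewrite !mutate_quiverE /mutated !hA !hP !hN.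
by split; case: i => -[|[|[|[|//]]]] ?; case: j => -[|[|[|[|//]]]] ? /=; lia.
Qed.

Lemma has_arrows_odd k Q : has_arrows odd_arrows (odd_frozen k.+1) Q ->
  has_arrows F0_arrows (even_frozen k.+2)
    (mutate_quiver (mutated 3) (mutate_quiver (mutated 2) Q)).
Proof.
move=> h i j.
have hA a b : Q (inl a) (inl b) = odd_arrows a b by case: (h a b).
have hP a b : Q (inr a) (inl b) = (odd_frozen k.+1 a b).1 by case: (h a b).
have hN a b : Q (inl b) (inr a) = (odd_frozen k.+1 a b).2 by case: (h a b).
rewrite !mutate_quiverE /mutated !hA !hP !hN.
by split; case: i => -[|[|[|[|//]]]] ?; case: j => -[|[|[|[|//]]]] ? /=; lia.
Qed.

Lemma has_arrows_seed m :
  has_arrows F0_arrows (even_frozen m.*2) (seed m.*2.*2).1 /\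
  has_arrows odd_arrows (odd_frozen m.*2.+1) (seed m.*2.+1.*2).1.
Proof.
have seedS n : (seed n.+1).1 = mutate_quiver (mutated n) (seed n).1.
  by rewrite /=; case: (seed n).
have mutE c n : mutated (c + n.*2.*2) = mutated c.
  by congr inl; apply: val_inj; rewrite /=; lia.
have mutS c n : (seed (c + n.*2.*2).+1).1 =
    mutate_quiver (mutated c) (seed (c + n.*2.*2)).1.
  by rewrite seedS mutE.
have odd_of_even n : has_arrows F0_arrows (even_frozen n.*2) (seed n.*2.*2).1 ->
    has_arrows odd_arrows (odd_frozen n.*2.+1) (seed n.*2.+1.*2).1.
  have -> : n.*2.+1.*2 = (1 + n.*2.*2).+1 by lia.
  rewrite mutS (mutS 0%N); exact: has_arrows_even.
have even_of_odd n : has_arrows odd_arrows (odd_frozen n.*2.+1) (seed n.*2.+1.*2).1 ->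
    has_arrows F0_arrows (even_frozen n.+1.*2) (seed n.+1.*2.*2).1.
  have -> : n.*2.+1.*2 = (2 + n.*2.*2)%N by lia.
  have -> : n.+1.*2.*2 = (3 + n.*2.*2).+1 by lia.
  rewrite mutS (mutS 2); exact: has_arrows_odd.
have he : has_arrows F0_arrows (even_frozen m.*2) (seed m.*2.*2).1.
  elim: m => [i j|m IH]; last exact/even_of_odd/odd_of_even.
  by split; case: i => -[|[|[|[|//]]]] ?; case: j => -[|[|[|[|//]]]] ?.
by split=> //; apply: odd_of_even.
Qed.

Lemma C_entry k i j :
  C k i j = let p := if odd k then odd_frozen k i j else even_frozen k i j in
            p.1%:Z - p.2%:Z.
Proof.
rewrite mxE; have [he ho] := has_arrows_seed k./2.
have := odd_double_half k; case: (odd k); rewrite /= ?add0n ?add1n => ek.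
- by rewrite ek in ho; have [_ -> ->] := ho i j.
- by rewrite ek in he; have [_ -> ->] := he i j.
Qed.

Lemma stable_exponentE k a : (0 < k)%N ->
  C k \in unitmx /\
  let b := invmx (C k) *m exponent_of a in
  stable_exponent k a = if odd k then b else swap_exponent b.
Proof.
case: k => // k _.
pose unswap e := if odd k.+1 then e else swap_exponent e.
have swapK e : swap_exponent (swap_exponent e) = e.
  apply/matrixP=> i j; rewrite ord1 !mxE; congr (e _ _); apply: val_inj.
  by case: i => -[|[|[|[|//]]]].
have CS b : C k.+1 *m unswap (stable_exponent k.+1 b) = exponent_of b.
  apply/matrixP=> i j; rewrite ord1 [LHS]mxE [RHS]mxE.
  rewrite !big_ord_recl big_ord0 !C_entry.
  have -> : b i = match val i with
                  | 0 => b 0%R | 1 => b 1%R | 2 => b 2%R | _ => b 3%R end%N.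
    by case: i => -[|[|[|[|//]]]] ? /=; congr (b _); apply: val_inj.
  rewrite /unswap; case: (odd k.+1); rewrite !mxE.
    by case: i => -[|[|[|[|//]]]] ? /=; rewrite ?intS; ring.
  by case: i => -[|[|[|[|//]]]] ? /=; rewrite ?subn1 ?subSS ?sub0n ?intS; ring.
pose N := \matrix_(i, j) unswap (stable_exponent k.+1 U_(j)%MM) i 0.
have CN : C k.+1 *m N = 1%:M.
  apply/matrixP=> i j; have /matrixP/(_ i 0) := CS U_(j)%MM.
  rewrite [LHS]mxE [RHS]mxE mnm1E eq_sym => e.
  rewrite [RHS]mxE natz -e [LHS]mxE.
  by apply: eq_bigr => l _; rewrite [N _ _]mxE.
have [Cu _] := mulmx1_unit CN.
split=> //=; rewrite -(CS a) mulKmx // /unswap.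
by rewrite /=; case: (odd k) => /=; rewrite ?swapK.
Qed.

(* Main.v *)
Require Import Defs.
From mathcomp Require Import all_boot all_order all_algebra.
From mathcomp Require Import fraction mpoly ring zify.

Set Implicit Arguments.
Unset Strict Implicit.
Unset Printing Implicit Defensive.

Import Order.TTheory GRing.Theory Num.Theory.
Local Open Scope ring_scope.

(** Each pair of mutations is one step of the recursion
      P_(k+2) P_k = P_(k+1)^2 + u_k Q_(k+1)^2,
      Q_(k+2) Q_k = Q_(k+1)^2 + v_k P_(k+1)^2,
    with P_0 = P_1 = Q_0 = Q_1 = 1, u_k = y_0^(k+1) y_2^k and
    v_k = y_1^(k+1) y_3^k, and G_(2k) = Q_(k+1).  The stable transformation at
    k maps u_j to u_(k-1-j) and v_j to v_(k-1-j): it reverses the coefficients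
    of the recursion.  The reversed recursion again has polynomial solutions
    (the Laurent phenomenon only uses that the coefficients form geometric
    progressions), and these are the stable F-polynomials.  Replacing k by k+1
    adds one step at the beginning of the reversed recursion, which is trivial
    up to terms of high degree; since all the divisions are by power series with
    constant term 1, the following steps preserve this congruence, so that each
    coefficient is eventually constant.

    Polynomiality is proved for u_k = alpha c_k and v_k = beta d_k with alpha
    and beta indeterminates.  The coprimality of P_k and Q_k reduces to that of
    P_k and 1 - u_j v_j; the latter is linear in alpha, hence prime, and does
    not divide P_k since it vanishes where all the variables are 1 whereas
    P_k is positive there. *)

(** * Divisibility and coprimality in an integral domain *)

Section Coprimality.
Variable R : idomainType.
Implicit Types f g h x : R.

Definition divides f x := exists y, x = y * f.

(** This is cancellability of [g] modulo [f], a form of coprimality that requires neither gcds nor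
    factorizations. *)
Definition coprime_to f g := forall x, divides f (g * x) -> divides f x.

Lemma dividesD f x y : divides f x -> divides f y -> divides f (x + y).
Proof. by move=> [a ->] [b ->]; exists (a + b); rewrite mulrDl. Qed.

Lemma divides_mull f x y : divides f x -> divides f (y * x).
Proof. by move=> [a ->]; exists (y * a); rewrite mulrA. Qed.

Lemma divides_mulr f x y : divides f x -> divides f (x * y).
Proof. by rewrite mulrC; apply: divides_mull. Qed.

Lemma divides_refl f : divides f f.
Proof. by exists 1; rewrite mul1r. Qed.

Lemma dividesB f x y : divides f x -> divides f y -> divides f (x - y).
Proof. by move=> [a ->] [b ->]; exists (a - b); rewrite mulrBl. Qed.

Lemma coprime_toM f g h :
  coprime_to f g -> coprime_to f h -> coprime_to f (g * h).
Proof. by move=> cg ch x; rewrite -mulrA => /cg/ch. Qed.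

Lemma coprime_toX f g n : coprime_to f g -> coprime_to f (g ^+ n).
Proof.
by move=> cg; elim: n => [x|n IHn]; rewrite ?expr0 ?mul1r // exprS; apply: coprime_toM.
Qed.

Lemma coprime_to_modr f g h :
  divides f (g - h) -> coprime_to f g -> coprime_to f h.
Proof.
move=> dgh cg x dx; apply: cg; rewrite -[g](subrK h) mulrDl.
by apply: dividesD => //; apply: divides_mulr.
Qed.

(** If [f * x = y * g], then [f] divides [y], and cancelling [f] exhibits [x] as a multiple of
    [g]. *)
Lemma coprime_to_sym f g : f != 0 -> coprime_to f g -> coprime_to g f.
Proof.
move=> f0 cfg x [y e]; have [|z ez] := cfg y; first by exists x; rewrite mulrC -e mulrC.
by exists z; apply: (mulfI f0); rewrite e ez; ring.
Qed.

Lemma coprime_to_factorr f g h : coprime_to f (g * h) -> coprime_to f g.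
Proof.
by move=> cgh x dx; apply: cgh; rewrite mulrAC; apply: divides_mulr.
Qed.

Lemma coprime_to1 f : coprime_to f 1.
Proof. by move=> x; rewrite mul1r. Qed.

Lemma coprime_1to g : coprime_to 1 g.
Proof. by move=> x _; exists x; rewrite mulr1. Qed.

Lemma coprime_to_mod1 f g : divides f (g - 1) -> coprime_to f g.
Proof.
move=> d; apply: (@coprime_to_modr _ 1); last exact: coprime_to1.
by rewrite -opprB -mulN1r; apply: divides_mull.
Qed.

End Coprimality.

(** * The exchange recursion and its Laurent phenomenon *)

Definition exchange_system (R : comNzRingType) (u v : nat -> R) (n : nat)
    (P Q : nat -> R) : Prop :=
  [/\ P 0%N = 1, P 1%N = 1, Q 0%N = 1, Q 1%N = 1 &
      forall k, (k.+2 <= n)%N ->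
        P k.+2 * P k = P k.+1 ^+ 2 + u k * Q k.+1 ^+ 2 /\
        Q k.+2 * Q k = Q k.+1 ^+ 2 + v k * P k.+1 ^+ 2].

Lemma exchange_systemC (R : comNzRingType) (u v : nat -> R) n P Q :
  exchange_system u v n P Q -> exchange_system v u n Q P.
Proof. by case=> p0 p1 q0 q1 rec; split=> // k /rec []. Qed.

Lemma exchange_system_map (R S : comNzRingType) (phi : {rmorphism R -> S})
    (u v : nat -> R) n P Q :
  exchange_system u v n P Q ->
  exchange_system (phi \o u) (phi \o v) n (phi \o P) (phi \o Q).
Proof.
case=> p0 p1 q0 q1 rec; split; rewrite /= ?p0 ?p1 ?q0 ?q1 ?rmorph1 // => k /rec [eP eQ].
by rewrite -!rmorphM eP eQ !(rmorphXn, rmorphD, rmorphM).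
Qed.

Section LaurentPhenomenon.
Variables (R : idomainType) (u v : nat -> R).

(** Modulo [p2], [p3 * p1] is [u1 * q2 ^+ 2] and [q3 * q1] is [q2 ^+ 2]. So after multiplication by
    [p1 ^+ 2 * q1 ^+ 2] the expression becomes [q2 ^+ 4 * (u1 ^+ 2 * q1 ^+ 2 + u2 * p1 ^+ 2)]. As
    [u1 ^+ 2 = u0 * u2], this equals [q2 ^+ 4 * u2 * (p2 * p0)]. *)
Lemma next_divides (p0 p1 p2 p3 q1 q2 q3 u0 u1 u2 v1 : R) :
    u1 ^+ 2 = u0 * u2 ->
    p2 * p0 = p1 ^+ 2 + u0 * q1 ^+ 2 ->
    p3 * p1 = p2 ^+ 2 + u1 * q2 ^+ 2 ->
    q3 * q1 = q2 ^+ 2 + v1 * p2 ^+ 2 ->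
    coprime_to p2 p1 -> coprime_to p2 q1 ->
  divides p2 (p3 ^+ 2 + u2 * q3 ^+ 2).
Proof.
move=> eu e2 e3 e3' c1 c2.
apply: (@coprime_toX _ _ _ 2 c1); apply: (@coprime_toX _ _ _ 2 c2).
exists ((p2 ^+ 3 + u1 * p2 * q2 ^+ 2 *+ 2) * q1 ^+ 2
        + u2 * p1 ^+ 2 * (v1 * p2 * q2 ^+ 2 *+ 2 + v1 ^+ 2 * p2 ^+ 3)
        + q2 ^+ 4 * u2 * p0).
transitivity ((p3 * p1) ^+ 2 * q1 ^+ 2 + u2 * p1 ^+ 2 * (q3 * q1) ^+ 2); first by ring.
rewrite e3 e3' !mulrDl.
have -> : q2 ^+ 4 * u2 * p0 * p2 = q2 ^+ 4 * u2 * (p2 * p0) by ring.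
rewrite e2.
transitivity ((p2 ^+ 4 + p2 ^+ 2 * u1 * q2 ^+ 2 *+ 2 + u1 ^+ 2 * q2 ^+ 4) * q1 ^+ 2
   + u2 * p1 ^+ 2 * (q2 ^+ 2 + v1 * p2 ^+ 2) ^+ 2); first by ring.
by rewrite eu; ring.
Qed.

Section Solution.
Variables (n : nat) (P Q : nat -> R).
Hypothesis PQ : exchange_system u v n P Q.
Hypothesis P0 : forall i, (i <= n)%N -> P i != 0.
Hypothesis Q0 : forall i, (i <= n)%N -> Q i != 0.
Hypothesis P_uv : forall i k, (i <= n)%N -> coprime_to (P i) (1 - u k * v k).

(** Modulo [Q k.+1], [P k.+2 * P k] is [P k.+1 ^+ 2], so [P k.+2] is coprime to [Q k.+1]. Modulo
    [P k.+2], [P k.+1 ^+ 2] is [- u k * Q k.+1 ^+ 2], which turns [Q k.+2 * Q k] into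
    [(1 - u k * v k) * Q k.+1 ^+ 2]. *)
Lemma coprime_PQ k : (k <= n)%N -> coprime_to (P k) (Q k).
Proof.
case: PQ => eP0 eP1 _ _ rec.
elim: k => [|[|k] IH] lekn; rewrite ?eP0 ?eP1; try exact: coprime_1to.
have [eP eQ] := rec k lekn.
have c1 : coprime_to (P k.+2) (Q k.+1).
  apply: coprime_to_sym; first by apply: Q0; lia.
  apply: (@coprime_to_factorr _ _ _ (P k)); rewrite eP.
  apply: (@coprime_to_modr _ _ (P k.+1 ^+ 2)).
    by exists (- (u k * Q k.+1)); ring.
  by apply/coprime_toX/coprime_to_sym/IH; [apply: P0; lia | lia].
apply: (@coprime_to_factorr _ _ _ (Q k)).
apply: (@coprime_to_modr _ _ ((1 - u k * v k) * Q k.+1 ^+ 2)).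
  exists (- v k * P k); rewrite eQ -mulrA [P k * _]mulrC eP; ring.
by apply: coprime_toM; [apply: P_uv | apply: coprime_toX].
Qed.

Hypothesis P_u : forall i k, (i <= n)%N -> coprime_to (P i) (u k).
Hypothesis u_geom : forall k, (k.+3 <= n)%N -> u k.+1 ^+ 2 = u k * u k.+2.

Lemma next_exists k : n = k.+1 -> exists x, x * P k = P k.+1 ^+ 2 + u k * Q k.+1 ^+ 2.
Proof.
case: PQ => eP0 eP1 _ _ rec en.
(* The first two divisions are by 1; [next_divides] takes over once three earlier steps are
   available. *)
case: k en => [|[|k]] en; rewrite ?eP0 ?eP1.
- by exists (1 + u 0%N * Q 1%N ^+ 2); ring.
- by exists (P 2 ^+ 2 + u 1%N * Q 2 ^+ 2); ring.
have [eP eQ] := rec k ltac:(lia); have [eP' eQ'] := rec k.+1 ltac:(lia).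
have cPQ : coprime_to (P k.+1) (Q k.+1) by apply: coprime_PQ; lia.
have [|||x ->] := next_divides (u_geom _) eP eP' eQ'; first by lia.
- apply: coprime_to_sym; first by apply: P0; lia.
  apply: (@coprime_to_factorr _ _ _ (P k)); rewrite eP.
  apply: (@coprime_to_modr _ _ (u k * Q k.+1 ^+ 2)).
    by exists (- P k.+1); ring.
  by apply: coprime_toM; [apply: P_u; lia | apply: coprime_toX].
- apply: coprime_to_sym; first by apply: Q0; lia.
  apply: (@coprime_to_factorr _ _ _ (P k)); rewrite eP.
  apply: (@coprime_to_modr _ _ (P k.+1 ^+ 2)).
    by exists (- (u k * Q k.+1)); ring.
  by apply/coprime_toX/coprime_to_sym => //; apply: P0; lia.
by exists x.
Qed.

End Solution.
End LaurentPhenomenon.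

(** * Coprimality and a linear prime in a polynomial ring *)

Section PolyCoprimality.
Variable B : idomainType.
Implicit Types (c m : B) (f g x : {poly B}).

Lemma divides_polyC c x : divides c%:P x <-> forall i, divides c x`_i.
Proof.
split=> [[y ->] i|dx]; first by exists y`_i; rewrite coefMC.
elim/poly_ind: x dx => [|x a IH] dx; first by exists 0; rewrite mul0r.
have [y ex] : divides c%:P x.
  by apply: IH => i; have := dx i.+1; rewrite coefD coefMX coefC /= addr0.
have [b eb] := dx 0%N; rewrite coefD coefMX coefC /= add0r in eb.
by exists (y * 'X + b%:P); rewrite ex eb polyCM; ring.
Qed.

(** By induction on [i]: the [i]-th coefficient of [f * x] is [f]_0 * x[_i] plus multiples of lower
    coefficients of [x], already divisible by [c]. *)
Lemma coprime_to_polyC c f : coprime_to c f`_0 -> coprime_to c%:P f.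
Proof.
move=> cf x /divides_polyC dfx; apply/divides_polyC => i.
elim/ltn_ind: i => i IH; apply: cf.
have := dfx i; rewrite coefM big_ord_recl subn0 /= => d.
have -> : f`_0 * x`_i = f`_0 * x`_i + \sum_(j < i) f`_(bump 0 j) * x`_(i - bump 0 j)
    - \sum_(j < i) f`_(bump 0 j) * x`_(i - bump 0 j) by rewrite addrK.
apply: dividesB => //; elim/big_ind: _ => [|a b|j _]; first by exists 0; rewrite mul0r.
  exact: dividesD.
by apply/divides_mull/IH; rewrite /bump /=; have := ltn_ord j; lia.
Qed.

Section LinearDivisor.
Variable m : B.
Hypothesis m0 : m != 0.
Let d : {poly B} := 1 - 'X * m%:P.

(** Pseudo-division: modulo [d] the product ['X * m] is 1, so enough factors [m] absorb all powers
    of ['X]. *)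
Lemma linear_remainder f : exists n c g, (m ^+ n)%:P * f = c%:P + g * d.
Proof.
elim/poly_ind: f => [|f a [n [c [g e]]]].
  by exists 0%N, 0, 0; rewrite mulr0 mul0r addr0.
exists n.+1, (c + m ^+ n.+1 * a), (g - (c%:P + g * d)).
transitivity ((m ^+ n)%:P * f * ('X * m%:P) + (m ^+ n.+1 * a)%:P).
  by rewrite exprSr !polyCM; ring.
by rewrite e polyCD /d; ring.
Qed.

Lemma divides_linear_polyC c : divides d c%:P -> c = 0.
Proof.
case=> g e; have [g0|g0] := eqVneq g 0.
  by move/(congr1 (coefp 0)): e; rewrite g0 mul0r /= coefC coef0.
have sd : size d = 2.
  have -> : d = (- m)%:P * 'X + 1%:P by rewrite /d polyCN mulNr mulrC polyC1; ring.
  by rewrite size_MXaddC polyC_eq0 oppr_eq0 (negPf m0) size_polyC oppr_eq0 m0.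
have := size_polyC_leq1 c; rewrite e size_mul // ?sd.
  by rewrite -size_poly_gt0 in g0; lia.
by rewrite -size_poly_eq0 sd.
Qed.

(** [m] is a unit modulo [d], with inverse ['X]. *)
Lemma divides_linear_cancel n f : divides d ((m ^+ n)%:P * f) -> divides d f.
Proof.
have : coprime_to d (m ^+ n)%:P.
  rewrite rmorphXn /=; apply: coprime_toX => x [y e].
  exists (x + 'X * y); rewrite mulrDl -mulrA -e /d; ring.
exact.
Qed.

(** Up to powers of [m], both factors reduce to constants [c] and [c']. Their product is a constant
    multiple of [d], hence 0 by degree, so one of them vanishes. *)
Lemma linear_prime f x : ~ divides d f -> divides d (f * x) -> divides d x.
Proof.
move=> ndf dfx; have [n [c [g e]]] := linear_remainder f.
have [n' [c' [g' e']]] := linear_remainder x.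
have : divides d (c * c')%:P.
  have -> : (c * c')%:P = (m ^+ n)%:P * (m ^+ n')%:P * (f * x)
       - (c%:P * g' + c'%:P * g + g * g' * d) * d.
    transitivity (((m ^+ n)%:P * f) * ((m ^+ n')%:P * x)
       - (c%:P * g' + c'%:P * g + g * g' * d) * d); last by ring.
    by rewrite e e' polyCM; ring.
  by apply: dividesB; apply: divides_mull => //; apply: divides_refl.
move/divides_linear_polyC/eqP; rewrite mulf_eq0 => /orP [/eqP c0|/eqP c0].
  by case: ndf; apply: (@divides_linear_cancel n); exists g; rewrite e c0 polyC0 add0r.
by apply: (@divides_linear_cancel n'); exists g'; rewrite e' c0 polyC0 add0r.
Qed.

End LinearDivisor.
End PolyCoprimality.

(** * Solutions with indeterminate leading coefficients *)

Section GenericSolution.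
Variables (A : idomainType) (one_eval : {rmorphism A -> int}).
Variables (c d : nat -> A).
Hypothesis c1 : forall k, one_eval (c k) = 1.
Hypothesis d1 : forall k, one_eval (d k) = 1.

Let R : idomainType := {poly {poly A}}.
Let alpha : R := 'X.
Let beta : R := 'X%:P.
Let u k : R := alpha * (c k)%:P%:P.
Let v k : R := beta * (d k)%:P%:P.

Let phi : {rmorphism R -> int} := one_eval \o horner_eval 1 \o horner_eval 1.

Lemma phi_u k : phi (u k) = 1.
Proof. by rewrite /phi /= /horner_eval /u !(hornerE, hornerM, hornerX, hornerC) c1. Qed.

Lemma phi_v k : phi (v k) = 1.
Proof. by rewrite /phi /= /horner_eval /v !(hornerE, hornerM, hornerX, hornerC) d1. Qed.

Section Properties.
Variables (n : nat) (P Q : nat -> R).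
Hypothesis PQ : exchange_system u v n P Q.

(** Under [phi] all coefficients become 1, and each new term is a sum of squares divided by a
    positive integer. *)
Lemma phi_gt0 i : (i <= n)%N -> 0 < phi (P i) /\ 0 < phi (Q i).
Proof.
case: PQ => eP0 eP1 eQ0 eQ1 rec.
elim/ltn_ind: i => -[|[|i]] IH lein; rewrite ?eP0 ?eP1 ?eQ0 ?eQ1 ?rmorph1 //.
have [eP eQ] := rec i lein.
have [p0 q0] := IH i ltac:(lia) ltac:(lia).
have [p1 q1] := IH i.+1 ltac:(lia) ltac:(lia).
split.
  rewrite -(pmulr_lgt0 _ p0) -rmorphM eP rmorphD [phi (u _ * _)]rmorphM phi_u !rmorphXn mul1r.
  by rewrite addr_gt0 // exprn_gt0.
rewrite -(pmulr_lgt0 _ q0) -rmorphM eQ rmorphD [phi (v _ * _)]rmorphM phi_v !rmorphXn mul1r.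
by rewrite addr_gt0 // exprn_gt0.
Qed.

(** Modulo [alpha] the recursion is [P k.+2 * P k = P k.+1 ^+ 2] with initial values 1. This makes
    [P i] coprime to [alpha], and its constant term 1 makes it coprime to the scalars [c k]. *)
Lemma congr1_alpha i : (i <= n)%N -> divides alpha (P i - 1).
Proof.
case: PQ => eP0 eP1 eQ0 eQ1 rec.
elim/ltn_ind: i => -[|[|i]] IH lein; rewrite ?eP0 ?eP1; try by exists 0; ring.
have [eP eQ] := rec i lein.
have dv0 := IH i ltac:(lia) ltac:(lia); have dv1 := IH i.+1 ltac:(lia) ltac:(lia).
have -> : P i.+2 - 1 = (P i.+1 - 1) * (P i.+1 + 1) + alpha * ((c i)%:P%:P * Q i.+1 ^+ 2)
   - P i.+2 * (P i - 1).
  by rewrite mulrBr eP /u; ring.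
apply: dividesB; last exact: divides_mull.
apply: dividesD; apply: divides_mulr => //; exact: divides_refl.
Qed.

Lemma congr1_beta i : (i <= n)%N -> divides beta (Q i - 1).
Proof.
case: PQ => eP0 eP1 eQ0 eQ1 rec.
elim/ltn_ind: i => -[|[|i]] IH lein; rewrite ?eQ0 ?eQ1; try by exists 0; ring.
have [eP eQ] := rec i lein.
have dv0 := IH i ltac:(lia) ltac:(lia); have dv1 := IH i.+1 ltac:(lia) ltac:(lia).
have -> : Q i.+2 - 1 = (Q i.+1 - 1) * (Q i.+1 + 1) + beta * ((d i)%:P%:P * P i.+1 ^+ 2)
   - Q i.+2 * (Q i - 1).
  by rewrite mulrBr eQ /v; ring.
apply: dividesB; last exact: divides_mull.
apply: dividesD; apply: divides_mulr => //; exact: divides_refl.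
Qed.

Lemma P_neq0 i : (i <= n)%N -> P i != 0.
Proof. by case/phi_gt0 => + _; apply: contraTneq => ->; rewrite rmorph0 ltxx. Qed.

Lemma Q_neq0 i : (i <= n)%N -> Q i != 0.
Proof. by case/phi_gt0 => _; apply: contraTneq => ->; rewrite rmorph0 ltxx. Qed.

Lemma c_neq0 k : c k != 0.
Proof. by apply: contra_eq_neq (c1 k) => ->; rewrite rmorph0. Qed.

Lemma d_neq0 k : d k != 0.
Proof. by apply: contra_eq_neq (d1 k) => ->; rewrite rmorph0. Qed.

Lemma coprime_to_scalar a (f : R) : a != 0 -> f`_0`_0 = 1 -> coprime_to f a%:P%:P.
Proof.
move=> a0 f1; apply: coprime_to_sym; first by rewrite !polyC_eq0.
by do 2 apply: coprime_to_polyC; rewrite f1; apply: coprime_to1.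
Qed.

Lemma coprime_P_u i k : (i <= n)%N -> coprime_to (P i) (u k).
Proof.
move=> lein; have da := congr1_alpha lein; apply: coprime_toM.
  by apply: coprime_to_sym; rewrite ?polyX_eq0 //; apply: coprime_to_mod1.
apply: coprime_to_scalar; first exact: c_neq0.
have [y /(congr1 (coefp 0))] := da.
by rewrite /= coefMX coefB coef1 => /eqP; rewrite subr_eq0 => /eqP ->; rewrite coef1.
Qed.

Lemma coprime_Q_v i k : (i <= n)%N -> coprime_to (Q i) (v k).
Proof.
move=> lein; have db := congr1_beta lein; apply: coprime_toM.
  by apply: coprime_to_sym; rewrite ?polyC_eq0 ?polyX_eq0 //; apply: coprime_to_mod1.
apply: coprime_to_scalar; first exact: d_neq0.
have [y /(congr1 (coefp 0 \o coefp 0))] := db.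
by rewrite /= coefMC coefMX !coefB !coef1 => /eqP; rewrite subr_eq0 => /eqP ->.
Qed.

Lemma coprime_uv k (f : R) : phi f != 0 -> coprime_to f (1 - u k * v k).
Proof.
move=> f0; have -> : 1 - u k * v k = 1 - 'X * ('X * (c k * d k)%:P)%:P.
  by rewrite /u /v /alpha /beta !polyCM; ring.
apply: coprime_to_sym.
  apply/eqP => /(congr1 (coefp 0 \o coefp 0)) /=.
  by rewrite coefB coefXM coef1 subr0 coef1 !coef0 /= => /eqP; rewrite oner_eq0.
move=> x; apply: linear_prime.
  by rewrite mulf_neq0 ?polyX_eq0 // polyC_eq0 mulf_neq0 ?c_neq0 ?d_neq0.
case=> y ey; move/negP: f0; apply; rewrite ey rmorphM.
have -> : phi (1 - 'X * ('X * (c k * d k)%:P)%:P) = 1 - phi (u k) * phi (v k).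
  rewrite -rmorphM -[1 in RHS](rmorph1 phi) -rmorphB /u /v /alpha /beta !polyCM.
  by congr (phi _); ring.
by rewrite phi_u phi_v mulr1 subrr mulr0.
Qed.
End Properties.

Lemma phi_neq0 n P Q i : exchange_system u v n P Q -> (i <= n)%N ->
  phi (P i) != 0 /\ phi (Q i) != 0.
Proof. by move=> PQ /(phi_gt0 PQ) [p0 q0]; rewrite !gt_eqF. Qed.

(** The bound [k.+4 <= n] involves only coefficients of index at most [n - 2], those that enter the
    recursion. The reversed coefficients, written with truncated subtraction, are geometric only in
    that range. *)
Lemma generic_solution n :
    (forall k, (k.+4 <= n)%N -> c k.+1 ^+ 2 = c k * c k.+2) ->
    (forall k, (k.+4 <= n)%N -> d k.+1 ^+ 2 = d k * d k.+2) ->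
  exists P Q, exchange_system u v n P Q.
Proof.
elim: n => [|n IHn] hc hd; first by exists (fun=> 1), (fun=> 1); split.
have [P [Q PQ]] : exists P Q, exchange_system u v n P Q.
  by apply: IHn => k lek; [apply: hc; lia | apply: hd; lia].
case: n => [|n] in IHn hc hd PQ *; first by exists (fun=> 1), (fun=> 1); split.
have [x ex] : exists x, x * P n = P n.+1 ^+ 2 + u n * Q n.+1 ^+ 2.
  apply: (next_exists PQ) => //.
  - exact: P_neq0 PQ.
  - exact: Q_neq0 PQ.
  - by move=> i k lei; apply: coprime_uv; case: (phi_neq0 PQ lei).
  - exact: coprime_P_u PQ.
  move=> k lek; have := congr1 (fun z => z%:P%:P : R) (hc k lek).
  by rewrite expr2 !polyCM => e; rewrite /u expr2 mulrACA e; ring.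
have [y ey] : exists y, y * Q n = Q n.+1 ^+ 2 + v n * P n.+1 ^+ 2.
  apply: (next_exists (exchange_systemC PQ)) => //.
  - exact: Q_neq0 PQ.
  - exact: P_neq0 PQ.
  - by move=> i k lei; rewrite mulrC; apply: coprime_uv; case: (phi_neq0 PQ lei).
  - exact: coprime_Q_v PQ.
  move=> k lek; have := congr1 (fun z => z%:P%:P : R) (hd k lek).
  by rewrite expr2 !polyCM => e; rewrite /v expr2 mulrACA e; ring.
exists (fun i => if i == n.+2 then x else P i), (fun i => if i == n.+2 then y else Q i).
case: PQ => eP0 eP1 eQ0 eQ1 rec; split=> // k; rewrite leq_eqVlt => /orP [/eqP [->]|lek].
  by rewrite eqxx !ltn_eqF.
by rewrite !ltn_eqF; [apply: rec | lia..].
Qed.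
End GenericSolution.

Lemma exchange_system_exists (A : idomainType) (one_eval : {rmorphism A -> int})
    (a b : A) (c d : nat -> A) (n : nat) :
    (forall k, one_eval (c k) = 1) -> (forall k, one_eval (d k) = 1) ->
    (forall k, (k.+4 <= n)%N -> c k.+1 ^+ 2 = c k * c k.+2) ->
    (forall k, (k.+4 <= n)%N -> d k.+1 ^+ 2 = d k * d k.+2) ->
  exists P Q, exchange_system (fun k => a * c k) (fun k => b * d k) n P Q.
Proof.
move=> c1 d1 hc hd; have [P [Q]] := generic_solution c1 d1 hc hd.
(* The recursion is stated without division, so it survives specialising [alpha], the outer
   variable, to [a] and then [beta] to [b]. *)
move/(exchange_system_map (horner_eval b \o horner_eval a%:P)).
case=> p0 p1 q0 q1 rec; eexists _, _; split; [exact: p0|exact: p1|exact: q0|exact: q1|].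
move=> k /rec []; rewrite /= /horner_eval.
by rewrite !(hornerM, hornerX, hornerC) => -> ->.
Qed.

(** * The systems of the F-polynomials and of their stable forms *)

Notation mpoly4 := {mpoly int[4]}.

(** The coefficient [u_j], split into the value ['X_0] of [alpha] and a geometric factor. *)
Definition xcoef (j : nat) : mpoly4 := 'X_0 * ('X_0 * 'X_2) ^+ j.
Definition ycoef (j : nat) : mpoly4 := 'X_1 * ('X_1 * 'X_3) ^+ j.

Definition Fsystem n (P Q : nat -> mpoly4) := exchange_system xcoef ycoef n P Q.

(* Solved by the images of an [Fsystem] under y^a |-> y^(stable_exponent k.+1 a). *)
Definition stable_system k (P Q : nat -> mpoly4) :=
  exchange_system (fun j => xcoef (k - j)) (fun j => ycoef (k - j)) k.+2 P Q.

Lemma Fsystem_exists n : exists P Q, Fsystem n P Q.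
Proof.
apply: (exchange_system_exists (one_eval := meval (fun=> 1))).
- by move=> k; rewrite rmorphXn rmorphM /= !mevalXU mulr1 expr1n.
- by move=> k; rewrite rmorphXn rmorphM /= !mevalXU mulr1 expr1n.
- by move=> k _; rewrite -exprM -exprD; congr (_ ^+ _); lia.
- by move=> k _; rewrite -exprM -exprD; congr (_ ^+ _); lia.
Qed.

Lemma stable_system_exists k : exists P Q, stable_system k P Q.
Proof.
apply: (exchange_system_exists (one_eval := meval (fun=> 1))).
- by move=> j; rewrite rmorphXn rmorphM /= !mevalXU mulr1 expr1n.
- by move=> j; rewrite rmorphXn rmorphM /= !mevalXU mulr1 expr1n.
- by move=> j le_jk; rewrite -exprM -exprD; congr (_ ^+ _); lia.
- by move=> j le_jk; rewrite -exprM -exprD; congr (_ ^+ _); lia.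
Qed.

(** * Cluster labels along the mutation sequence *)

Definition labels_are (l : labelling) (x0 x1 x2 x3 : {fraction mpoly4}) :=
  (forall i : 'I_4,
     l (inl i) = match val i with 0%N => x0 | 1%N => x1 | 2%N => x2 | _ => x3 end)
  /\ (forall i : 'I_4, l (inr i) = tofrac 'X_i).

Lemma big_vertex (f : vertex -> {fraction mpoly4}) :
  \prod_u f u = f (inl 0) * f (inl 1) * f (inl 2) * f (inl 3) *
    (f (inr 0) * f (inr 1) * f (inr 2) * f (inr 3)).
Proof.
rewrite big_sumType /= !big_ord_recl !big_ord0 /= !mulr1 !mulrA.
by do ![congr (_ * _)]; congr (f (_ _)); apply: val_inj.
Qed.

Lemma tofrac_xcoef k : tofrac (xcoef k) = tofrac 'X_0 ^+ k.+1 * tofrac 'X_2 ^+ k.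
Proof. by rewrite /xcoef tofracM tofracXn tofracM exprMn mulrA -exprS. Qed.

Lemma tofrac_ycoef k : tofrac (ycoef k) = tofrac 'X_1 ^+ k.+1 * tofrac 'X_3 ^+ k.
Proof. by rewrite /ycoef tofracM tofracXn tofracM exprMn mulrA -exprS. Qed.

(** Vertices 0 and 1 are not adjacent, so the second mutation does not see the new label at 0; the
    arrows to frozen vertices contribute [xcoef k] and [ycoef k]. *)
Lemma labels_even k Q l x0 x1 x2 x3 :
  has_arrows F0_arrows (even_frozen k) Q -> labels_are l x0 x1 x2 x3 ->
  labels_are
    (mutate_labels (mutated 1) (mutate_quiver (mutated 0) Q) (mutate_labels (mutated 0) Q l))
    ((x2 ^+ 2 + tofrac (xcoef k) * x3 ^+ 2) / x0)
    ((x3 ^+ 2 + tofrac (ycoef k) * x2 ^+ 2) / x1) x2 x3.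
Proof.
move=> h [hl hr].
have hA a b : Q (inl a) (inl b) = F0_arrows a b by case: (h a b).
have hP a b : Q (inr a) (inl b) = (even_frozen k a b).1 by case: (h a b).
have hN a b : Q (inl b) (inr a) = (even_frozen k a b).2 by case: (h a b).
split=> i; last by rewrite /mutate_labels /mutated /= hr.
rewrite /mutate_labels /mutated !big_vertex !mutate_quiverE !hA !hP !hN !hl !hr.
case: i => -[|[|[|[|//]]]] ? //=;
  rewrite ?tofrac_xcoef ?tofrac_ycoef; congr (_ / _);
  rewrite ?(muln0, mul0n, addn0, add0n, subn0, sub0n, subnn);
  by rewrite !expr0 !(mulr1, mul1r) [_ * (_ * _)]mulrC.
Qed.

Lemma labels_odd k Q l x0 x1 x2 x3 :
  has_arrows odd_arrows (odd_frozen k.+1) Q -> labels_are l x0 x1 x2 x3 ->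
  labels_are
    (mutate_labels (mutated 3) (mutate_quiver (mutated 2) Q) (mutate_labels (mutated 2) Q l))
    x0 x1 ((x0 ^+ 2 + tofrac (xcoef k.+1) * x1 ^+ 2) / x2)
    ((x1 ^+ 2 + tofrac (ycoef k.+1) * x0 ^+ 2) / x3).
Proof.
move=> h [hl hr].
have hA a b : Q (inl a) (inl b) = odd_arrows a b by case: (h a b).
have hP a b : Q (inr a) (inl b) = (odd_frozen k.+1 a b).1 by case: (h a b).
have hN a b : Q (inl b) (inr a) = (odd_frozen k.+1 a b).2 by case: (h a b).
split=> i; last by rewrite /mutate_labels /mutated /= hr.
rewrite /mutate_labels /mutated !big_vertex !mutate_quiverE !hA !hP !hN !hl !hr.
case: i => -[|[|[|[|//]]]] ? //=;
  rewrite ?tofrac_xcoef ?tofrac_ycoef; congr (_ / _);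
  rewrite ?(muln0, mul0n, addn0, add0n, subn0, sub0n, subnn);
  by rewrite !expr0 !(mulr1, mul1r) [_ * (_ * _)]mulrC.
Qed.

(** The vertex pairs (0,1) and (2,3) carry two consecutive terms, and each double mutation replaces
    the older one; parity tells which pair is older. *)
Lemma seed_labels n P Q k : Fsystem n P Q -> (forall i, (i <= n)%N -> P i != 0 /\ Q i != 0) ->
  (k.+1 <= n)%N ->
  let p i := tofrac (P i) in let q i := tofrac (Q i) in
  if odd k then labels_are (seed k.*2).2 (p k.+1) (q k.+1) (p k) (q k)
  else labels_are (seed k.*2).2 (p k) (q k) (p k.+1) (q k.+1).
Proof.
case=> p0 p1 q0 q1 rec nz lekn p q; rewrite {}/p {}/q.
elim: k lekn => [|k IH] lekn.
  split=> i //=; rewrite p0 p1 q0 q1 rmorph1.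
  by case: i => -[|[|[|[|//]]]].
have {}IH := IH ltac:(lia); have [eP eQ] := rec k lekn.
have [nzP nzQ] := nz k ltac:(lia).
have [ha1 ha2] := has_arrows_seed k./2.
have seedS m : seed m.+1 =
    (mutate_quiver (mutated m) (seed m).1, mutate_labels (mutated m) (seed m).1 (seed m).2).
  by rewrite /=; case: (seed m).
have mutE c m : mutated (c + m.*2.*2) = mutated c.
  by congr inl; apply: val_inj; rewrite /=; lia.
have ep : tofrac (P k.+2) =
    (tofrac (P k.+1) ^+ 2 + tofrac (xcoef k) * tofrac (Q k.+1) ^+ 2) / tofrac (P k).
  apply: (canRL (mulfK _)); first by rewrite tofrac_eq0.
  by rewrite -tofracM eP tofracD (tofracM (xcoef k)) !tofracXn.
have eq : tofrac (Q k.+2) =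
    (tofrac (Q k.+1) ^+ 2 + tofrac (ycoef k) * tofrac (P k.+1) ^+ 2) / tofrac (Q k).
  apply: (canRL (mulfK _)); first by rewrite tofrac_eq0.
  by rewrite -tofracM eQ tofracD (tofracM (ycoef k)) !tofracXn.
rewrite ep eq oddS; have := odd_double_half k.
case: (odd k) IH => IH; rewrite ?add0n ?add1n => ek; rewrite [~~ _]/=.
- have m2 : mutated k.*2 = mutated 2 by rewrite -(mutE 2 k./2); congr mutated; lia.
  have m3 : mutated k.*2.+1 = mutated 3 by rewrite -(mutE 3 k./2); congr mutated; lia.
  rewrite doubleS !seedS m2 m3 -[in tofrac (xcoef _)]ek -[in tofrac (ycoef _)]ek.
  by apply: labels_odd => //; rewrite [in seed _]ek in ha2.
- have m0 : mutated k.*2 = mutated 0 by rewrite -(mutE 0%N k./2); congr mutated; lia.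
  have m1 : mutated k.*2.+1 = mutated 1 by rewrite -(mutE 1%N k./2); congr mutated; lia.
  rewrite doubleS !seedS m0 m1.
  by apply: labels_even => //; rewrite ek in ha1.
Qed.

Lemma G_double P Q k : Fsystem k.+2 P Q ->
  (forall i, (i <= k.+2)%N -> P i != 0 /\ Q i != 0) -> G k.+1.*2 = tofrac (Q k.+2).
Proof.
move=> sys nz; have := seed_labels sys nz (leqnn _).
rewrite /G; have := odd_double_half k.+1.
case: (odd k.+1) => ek [hl _].
  have -> : mutated k.+1.*2.-1 = inl 1 by congr inl; apply: val_inj; rewrite /=; lia.
  by rewrite hl.
have -> : mutated k.+1.*2.-1 = inl 3 by congr inl; apply: val_inj; rewrite /=; lia.
by rewrite hl.
Qed.

(** * Congruences up to a given total degree *)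

Section Truncation.
Variable n : nat.
Implicit Types p q z : {mpoly int[n]}.

(** Membership in the [N]-th power of the ideal generated by the variables. *)
Definition vanishes_below (N : nat) p := forall m, (mdeg m < N)%N -> p@_m = 0.

Lemma vanishes_belowD N p q :
  vanishes_below N p -> vanishes_below N q -> vanishes_below N (p + q).
Proof. by move=> hp hq m hm; rewrite mcoeffD hp ?hq ?addr0. Qed.

Lemma vanishes_belowB N p q :
  vanishes_below N p -> vanishes_below N q -> vanishes_below N (p - q).
Proof. by move=> hp hq m hm; rewrite mcoeffB hp ?hq ?subr0. Qed.

Lemma vanishes_belowM M N p q :
  vanishes_below M p -> vanishes_below N q -> vanishes_below (M + N) (p * q).
Proof.
move=> hp hq m hm; rewrite mcoeffM big1 // => -[[k1 ?] [k2 ?]] /= /eqP e.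
move: hm; rewrite e mdegD; case: (ltnP (mdeg k1) M) => [/hp -> _|le1 lt2].
  by rewrite mul0r.
by rewrite hq ?mulr0 //; lia.
Qed.

Lemma vanishes_belowMl N p q : vanishes_below N q -> vanishes_below N (p * q).
Proof. exact: (@vanishes_belowM 0). Qed.

Lemma vanishes_below1 p : p@_0 = 0 -> vanishes_below 1 p.
Proof. by move=> p0 m; rewrite ltnS leqn0 mdeg_eq0 => /eqP ->. Qed.

(** In [z = p * z + (1 - p) * z] the factor [1 - p] has no constant term, so the order of vanishing
    of [z] can be raised one degree at a time up to [N]. *)
Lemma vanishes_below_cancel N p z :
  p@_0 = 1 -> vanishes_below N (p * z) -> vanishes_below N z.
Proof.
move=> p1 pz.
suff h j : (j <= N)%N -> vanishes_below j z by apply: h.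
elim: j => // j IH jN.
have -> : z = p * z + (1 - p) * z by ring.
apply: vanishes_belowD => [m hm|]; first by apply: pz; apply: leq_trans jN.
apply: (@vanishes_belowM 1); last by apply: IH; lia.
by apply: vanishes_below1; rewrite mcoeffB mcoeff1 p1 eqxx subrr.
Qed.

End Truncation.

(** * Constant terms and stabilisation of the reversed recursion *)

Lemma exchange_system_mcoeff0 (u v : nat -> mpoly4) n P Q i :
  (forall k, (u k)@_0 = 0) -> (forall k, (v k)@_0 = 0) ->
  exchange_system u v n P Q -> (i <= n)%N -> (P i)@_0 = 1 /\ (Q i)@_0 = 1.
Proof.
move=> u0 v0 [p0 p1 q0 q1 rec].
have step (a b w x y : mpoly4) : x * a = b ^+ 2 + w * y ^+ 2 ->
    a@_0 = 1 -> b@_0 = 1 -> w@_0 = 0 -> x@_0 = 1.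
  move=> e a1 b1 w0; rewrite -[LHS]mulr1 -[X in _ * X]a1 -rmorphM e.
  by rewrite rmorphD (rmorphM _ w) (rmorphXn _ 2 b) /= b1 w0 mul0r addr0 expr1n.
elim/ltn_ind: i => -[|[|i]] IH lein; rewrite ?p0 ?p1 ?q0 ?q1 ?rmorph1 //.
have [eP eQ] := rec i lein.
have [P0 Q0] := IH i ltac:(lia) ltac:(lia).
have [P1 Q1] := IH i.+1 ltac:(lia) ltac:(lia).
by split; [apply: step eP _ _ _ | apply: step eQ _ _ _].
Qed.

Lemma mcoeff0X (i : 'I_4) : ('X_i : mpoly4)@_0 = 0.
Proof. by rewrite mcoeffX -mdeg_eq0 mdeg1. Qed.

Lemma xcoef_mcoeff0 j : (xcoef j)@_0 = 0.
Proof. by rewrite [LHS]rmorphM /= mcoeff0X mul0r. Qed.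

Lemma ycoef_mcoeff0 j : (ycoef j)@_0 = 0.
Proof. by rewrite [LHS]rmorphM /= mcoeff0X mul0r. Qed.

Lemma mcoeff0_neq0 (p : mpoly4) : p@_0 = 1 -> p != 0.
Proof. by move=> p1; apply/eqP => p0; rewrite p0 mcoeff0 in p1. Qed.

Lemma Fsystem_neq0 n P Q : Fsystem n P Q ->
  forall i, (i <= n)%N -> P i != 0 /\ Q i != 0.
Proof.
move=> s i lein; have [p q] := exchange_system_mcoeff0 xcoef_mcoeff0 ycoef_mcoeff0 s lein.
by split; apply: mcoeff0_neq0.
Qed.

Lemma stable_mcoeff0 k P Q : stable_system k P Q ->
  forall i, (i <= k.+2)%N -> (P i)@_0 = 1 /\ (Q i)@_0 = 1.
Proof.
move=> s i; apply: (exchange_system_mcoeff0 _ _ s) => j.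
  exact: xcoef_mcoeff0.
exact: ycoef_mcoeff0.
Qed.

Lemma vanishes_belowX j (p : mpoly4) : p@_0 = 0 -> vanishes_below j (p ^+ j).
Proof.
move=> p0; elim: j => // j IH; rewrite exprS.
by apply: (@vanishes_belowM _ 1) => //; apply: vanishes_below1.
Qed.

Lemma vanishes_below_xcoef j : vanishes_below j (xcoef j).
Proof.
by apply/vanishes_belowMl/vanishes_belowX; rewrite [LHS]rmorphM /= mcoeff0X mul0r.
Qed.

Lemma vanishes_below_ycoef j : vanishes_below j (ycoef j).
Proof.
by apply/vanishes_belowMl/vanishes_belowX; rewrite [LHS]rmorphM /= mcoeff0X mul0r.
Qed.

Lemma quotient_congr N (a a' b b' x x' y y' w : mpoly4) :
  x * a = b ^+ 2 + w * y ^+ 2 -> x' * a' = b' ^+ 2 + w * y' ^+ 2 ->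
  a@_0 = 1 -> vanishes_below N (a' - a) -> vanishes_below N (b' - b) ->
  vanishes_below N (y' - y) -> vanishes_below N (x' - x).
Proof.
move=> e e' a1 da db dy; apply: (vanishes_below_cancel a1).
have -> : a * (x' - x) = x' * a' - x * a - x' * (a' - a) by ring.
rewrite e e'.
have -> : b' ^+ 2 + w * y' ^+ 2 - (b ^+ 2 + w * y ^+ 2)
   = (b' + b) * (b' - b) + w * (y' + y) * (y' - y) by ring.
by apply: vanishes_belowB; [apply: vanishes_belowD|]; apply: vanishes_belowMl.
Qed.

(** Since [k.+1 - i.+1 = k - i], step [i.+1] of the longer system has the coefficients of step [i]
    of the shorter one. The extra first step only adds [xcoef k.+1] or [ycoef k.+1], which vanish
    below degree [k.+1], and [quotient_congr] propagates this. *)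
Lemma stable_congr k P Q P' Q' i :
  stable_system k P Q -> stable_system k.+1 P' Q' -> (i <= k.+2)%N ->
  vanishes_below k.+1 (P' i.+1 - P i) /\ vanishes_below k.+1 (Q' i.+1 - Q i).
Proof.
move=> s s'; have c1 := stable_mcoeff0 s.
case: s s' => p0 p1 q0 q1 rec [p0' p1' q0' q1' rec'].
elim/ltn_ind: i => -[|[|i]] IH lein.
- by rewrite p0 p1' q0 q1' !subrr; split=> m _; rewrite mcoeff0.
- have [] := rec' 0%N isT; rewrite p0' p1' q0' q1' !mulr1 => -> ->.
  rewrite p1 q1 expr1n !mulr1 subn0 ![1 + _]addrC !addrK.
  by split; [apply: vanishes_below_xcoef | apply: vanishes_below_ycoef].
have [eP eQ] := rec i lein; have [eP' eQ'] := rec' i.+1 lein.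
have [dp0 dq0] := IH i ltac:(lia) ltac:(lia).
have [dp1 dq1] := IH i.+1 ltac:(lia) ltac:(lia).
have [p01 q01] := c1 i ltac:(lia).
by split; [apply: (quotient_congr eP eP') | apply: (quotient_congr eQ eQ')].
Qed.

(** * The stable transformation as a ring morphism *)

Definition laurent_monomial (e : exponent) : {fraction mpoly4} :=
  \prod_i tofrac 'X_i ^ e i 0.

Lemma tofracX_neq0 (i : 'I_4) : tofrac ('X_i : mpoly4) != 0.
Proof.
rewrite tofrac_eq0; apply/eqP => /(congr1 (mcoeff U_(i))).
by rewrite mcoeffX eqxx mcoeff0.
Qed.

Lemma laurent_monomialD e f :
  laurent_monomial (e + f) = laurent_monomial e * laurent_monomial f.
Proof.
rewrite -big_split; apply: eq_bigr => i _.
by rewrite mxE expfzDr ?tofracX_neq0.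
Qed.

Lemma laurent_monomial0 : laurent_monomial 0 = 1.
Proof. by apply: big1 => i _; rewrite mxE expr0z. Qed.

Lemma laurent_monomial_exponent_of (m : 'X_{1..4}) :
  laurent_monomial (exponent_of m) = tofrac 'X_[m].
Proof.
rewrite mpolyXE_id rmorph_prod; apply: eq_bigr => i _.
by rewrite mxE -exprnP [RHS]rmorphXn.
Qed.

Lemma stable_exponentD k a b :
  stable_exponent k (a + b)%MM = stable_exponent k a + stable_exponent k b.
Proof.
apply/matrixP => i j; rewrite !mxE !mnmDE !PoszD.
by case: (val i) => [|[|[|?]]]; ring.
Qed.

Lemma stable_exponent0 k : stable_exponent k 0%MM = 0.
Proof.
apply/matrixP => i j; rewrite !mxE !mnm0E.
by case: (val i) => [|[|[|?]]]; ring.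
Qed.

(** As a ring morphism the transformation can be applied to the recursion; the fraction field
    accommodates negative exponents. *)
Definition stable_map (k : nat) : {rmorphism mpoly4 -> {fraction mpoly4}} :=
  mmap (intr : int -> {fraction mpoly4})
       (fun i => laurent_monomial (stable_exponent k U_(i)%MM)).

Lemma stable_mapE k p :
  stable_map k p = \sum_(a <- msupp p) (p@_a)%:~R * laurent_monomial (stable_exponent k a).
Proof.
apply: eq_bigr => a _; congr (_ * _).
pose f a := laurent_monomial (stable_exponent k a).
have fD : {morph f : a b / (a + b)%MM >-> a * b}.
  by move=> b c; rewrite /f stable_exponentD laurent_monomialD.
have f0 : f 0%MM = 1 by rewrite /f stable_exponent0 laurent_monomial0.
rewrite [in RHS](multinomUE_id a) -/(f _) (big_morph f fD f0); apply: eq_bigr => i _.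
elim: (a i) => [|j IH]; first by rewrite mulm0n f0 expr0.
by rewrite mulmS fD -IH exprS.
Qed.

Lemma stable_mapX k i : stable_map k 'X_i = laurent_monomial (stable_exponent k U_(i)%MM).
Proof. by rewrite [LHS]mmapX mmap1U. Qed.

Lemma laurent_monomial4 e : laurent_monomial e =
  tofrac 'X_0 ^ e 0 0 * tofrac 'X_1 ^ e 1 0 * tofrac 'X_2 ^ e 2 0 * tofrac 'X_3 ^ e 3 0.
Proof.
rewrite /laurent_monomial !big_ord_recl !big_ord0 /= mulr1 !mulrA.
by do ![congr (_ * _)]; congr (tofrac 'X__ ^ e _ _); apply: val_inj.
Qed.

(** With [x = y_0] and [z = y_2], the two monomials are the images of [y_0] and [y_2] at [k.+1].
    Their product is [(x * z)^-1], which reverses the geometric progression. *)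
Lemma reversed_coef (F : fieldType) (x z : F) k j : x != 0 -> z != 0 -> (j <= k)%N ->
  x ^+ k.+1 * z ^+ k * (x ^+ k.+1 * z ^+ k * (x ^- k.+2 * z ^- k.+1)) ^+ j
  = x * (x * z) ^+ (k - j).
Proof.
move=> x0 z0 le_jk.
have -> : x ^+ k.+1 * z ^+ k * (x ^- k.+2 * z ^- k.+1) = (x * z)^-1.
  have := expf_neq0 k.+1 x0; have := expf_neq0 k z0; rewrite !(exprS _ k.+1) (exprS z).
  by move: (x ^+ k.+1) (z ^+ k) => X Z Z0 X0; field; rewrite x0 z0 X0 Z0.
rewrite exprS -[x * _ * _]mulrA -exprMn exprVn -mulrA; congr (_ * _).
by rewrite -{1}(subnK le_jk) exprD mulfK // expf_neq0 // mulf_neq0.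
Qed.

Lemma stable_map_xcoef k j : (j <= k)%N ->
  stable_map k.+1 (xcoef j) = tofrac (xcoef (k - j)).
Proof.
move=> le_jk; rewrite /xcoef !rmorphM !rmorphXn !rmorphM /= !stable_mapX.
rewrite !laurent_monomial4 !mxE !mnm1E /=.
rewrite !(mulr0, mulr1, subr0, sub0r, oppr0, expr0z, mul1r) -predn_int //=.
rewrite -!exprnN -!exprnP.
by rewrite reversed_coef ?tofracX_neq0.
Qed.

Lemma stable_map_ycoef k j : (j <= k)%N ->
  stable_map k.+1 (ycoef j) = tofrac (ycoef (k - j)).
Proof.
move=> le_jk; rewrite /ycoef !rmorphM !rmorphXn !rmorphM /= !stable_mapX.
rewrite !laurent_monomial4 !mxE !mnm1E /=.
rewrite !(mulr0, mulr1, subr0, sub0r, oppr0, expr0z, mul1r) -predn_int //=.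
rewrite -!exprnN -!exprnP.
by rewrite reversed_coef ?tofracX_neq0.
Qed.

(** Both sides satisfy the same recursion with the same initial values, and the divisors [P' i] and
    [Q' i] are nonzero. *)
Lemma stable_map_system k P Q P' Q' i :
  Fsystem k.+2 P Q -> stable_system k P' Q' -> (i <= k.+2)%N ->
  stable_map k.+1 (P i) = tofrac (P' i) /\ stable_map k.+1 (Q i) = tofrac (Q' i).
Proof.
move=> s s'; have nz j : (j <= k.+2)%N -> P' j != 0 /\ Q' j != 0.
  by move=> /(stable_mcoeff0 s') [] /mcoeff0_neq0 ? /mcoeff0_neq0.
have step (a b w x y a' b' w' x' y' : mpoly4) :
    x * a = b ^+ 2 + w * y ^+ 2 -> x' * a' = b' ^+ 2 + w' * y' ^+ 2 ->
    stable_map k.+1 a = tofrac a' -> stable_map k.+1 b = tofrac b' ->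
    stable_map k.+1 w = tofrac w' -> stable_map k.+1 y = tofrac y' -> a' != 0 ->
    stable_map k.+1 x = tofrac x'.
  move=> e e' ea eb ew ey a0; apply: (mulIf (_ : tofrac a' != 0)); first by rewrite tofrac_eq0.
  rewrite -{1}ea -rmorphM -tofracM e e' rmorphD tofracD (rmorphM _ w) (tofracM w').
  by rewrite (rmorphXn _ 2 b) (rmorphXn _ 2 y) !tofracXn /= eb ew ey.
case: s s' => p0 p1 q0 q1 rec [p0' p1' q0' q1' rec'].
elim/ltn_ind: i => -[|[|i]] IH lein.
- by rewrite p0 q0 p0' q0' !rmorph1.
- by rewrite p1 q1 p1' q1' !rmorph1.
have [eP eQ] := rec i lein; have [eP' eQ'] := rec' i lein.
have [dp0 dq0] := IH i ltac:(lia) ltac:(lia).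
have [dp1 dq1] := IH i.+1 ltac:(lia) ltac:(lia).
have [nzP nzQ] := nz i ltac:(lia).
split.
  by apply: (step _ _ _ _ _ _ _ _ _ _ eP eP') => //; apply: stable_map_xcoef; lia.
by apply: (step _ _ _ _ _ _ _ _ _ _ eQ eQ') => //; apply: stable_map_ycoef; lia.
Qed.

Lemma stable_coefE k (p T : mpoly4) e :
  stable_map k p = tofrac T -> stable_coef k p e = series_coef (fun m => T@_m) e.
Proof.
rewrite stable_mapE => eT.
(* [N] bounds every exponent in play in absolute value: multiplying by ['X_[shift]] moves the
   comparison into the polynomial ring. *)
pose N := (\sum_(a <- msupp p) \sum_i absz (stable_exponent k a i 0%R)
           + \sum_i absz (e i 0%R))%N.
pose shift : 'X_{1..4} := [multinom N | i < 4].
pose up (f : exponent) : 'X_{1..4} := [multinom absz (f i 0 + N%:Z)%R | i < 4].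
have upE (f : exponent) : (forall i, - N%:Z <= f i 0) ->
    exponent_of (up f) = f + exponent_of shift.
  by move=> hf; apply/matrixP => i j; rewrite ord1 !mxE !mnmE gez0_abs //; have := hf i; lia.
have le_e i : - N%:Z <= e i 0.
  have : (absz (e i 0%R) <= N)%N by rewrite /N (bigD1 i (P := xpredT)) //=; lia.
  by lia.
have le_p a : a \in msupp p -> forall i, - N%:Z <= stable_exponent k a i 0.
  move=> ain i; have : (absz (stable_exponent k a i 0%R) <= N)%N.
    by rewrite /N (bigD1_seq a) //= (bigD1 i) //=; lia.
  by lia.
have eN : \sum_(a <- msupp p) p@_a *: 'X_[up (stable_exponent k a)] = T * 'X_[shift].
  apply/eqP; rewrite -tofrac_eq tofracM -eT -laurent_monomial_exponent_of mulr_suml.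
  rewrite rmorph_sum /=; apply/eqP; rewrite big_seq [RHS]big_seq; apply: eq_bigr => a ain.
  rewrite -mulrA -laurent_monomialD -upE; last exact: le_p.
  by rewrite laurent_monomial_exponent_of -mul_mpolyC rmorphM /= -[p@_a]intz !rmorph_int.
have -> : stable_coef k p e = (T * 'X_[shift])@_(up e).
  rewrite -eN raddf_sum /= /stable_coef big_mkcond big_seq [RHS]big_seq.
  apply: eq_bigr => a ain; rewrite mcoeffZ mcoeffX.
  have -> : (up (stable_exponent k a) == up e) = (stable_exponent k a == e).
    apply/eqP/eqP => [h|-> //]; apply: (addIr (exponent_of shift)).
    by rewrite -!upE ?h //; apply: le_p.
  by case: ifP; rewrite ?mulr1 ?mulr0.
rewrite /series_coef; case: ifPn => [/forallP e0|].
  rewrite -[RHS](mcoeffMX _ shift); congr (_ @_ _).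
  apply/mnmP => i; rewrite mnmDE !mnmE; have := e0 i; lia.
(* With a negative entry in [e], some exponent of [up e] is below [N], so its monomial cannot occur
   in a multiple of ['X_[shift]]. *)
case/forallPn => i; rewrite -ltNge => ei.
rewrite mcoeffM big1 // => -[[k1 ?] [k2 ?]] /= /eqP ek; rewrite mcoeffX.
case: eqP => [k2E|]; last by rewrite mulr0.
move/mnmP: ek => /(_ i); rewrite mnmDE -k2E !mnmE; have := le_e i; lia.
Qed.

(** * Coefficientwise convergence *)

Lemma series_coef_exponent_of S m : series_coef S (exponent_of m) = S m.
Proof.
rewrite /series_coef; case: ifPn => [_|/forallPn [i]]; last by rewrite mxE.
by congr S; apply/mnmP => i; rewrite mnmE mxE.
Qed.

Theorem theorem5p3 :
  exists F : nat -> {mpoly int[4]},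
    (forall k : nat, (0 < k)%N -> tofrac (F k) = G k.*2)
    /\ converges_as_power_series (fun k => stable_coef k (F k)).
Proof.
have exF k : exists p : mpoly4, tofrac p == G k.+1.*2.
  have [P [Q s]] := Fsystem_exists k.+2.
  by exists (Q k.+2); rewrite (G_double s (Fsystem_neq0 s)).
pose F k := xchoose (exF k.-1).
have FE k : tofrac (F k.+1) = G k.+1.*2 by apply/eqP/(xchooseP (exF k)).
have coefE k P' Q' : stable_system k P' Q' -> forall e,
    stable_coef k.+1 (F k.+1) e = series_coef (fun m => (Q' k.+2)@_m) e.
  move=> s' e; apply: stable_coefE; have [P [Q s]] := Fsystem_exists k.+2.
  have -> : F k.+1 = Q k.+2.
    by apply/eqP; rewrite -tofrac_eq FE (G_double s (Fsystem_neq0 s)).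
  by have [] := stable_map_system s s' (leqnn _).
exists F; split=> [[]//|].
(* From this index on, consecutive stable polynomials agree in degree [mdeg m], by
   [stable_congr]. *)
pose S m := stable_coef (mdeg m).+1 (F (mdeg m).+1) (exponent_of m).
have stable m k : (mdeg m <= k)%N -> stable_coef k.+1 (F k.+1) (exponent_of m) = S m.
  elim: k => [|k IH]; first by rewrite leqn0 /S => /eqP ->.
  rewrite leq_eqVlt => /orP [/eqP <- //|lt_mk].
  rewrite -IH //; have [P [Q s]] := stable_system_exists k.
  have [P' [Q' s']] := stable_system_exists k.+1.
  rewrite (coefE _ _ _ s) (coefE _ _ _ s') !series_coef_exponent_of.
  have [_ /(_ m lt_mk)/eqP] := stable_congr s s' (leqnn _).
  by rewrite mcoeffB subr_eq0 => /eqP.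
exists S => e; have [e0|e_neg] := boolP [forall i, 0 <= e i 0]; last first.
  (* From index 1 on, the image is a genuine polynomial, so coefficients at negative exponents are
     0. *)
  exists 1%N => -[//|k] _; have [P [Q s]] := stable_system_exists k.
  by rewrite (coefE _ _ _ s) /series_coef (negPf e_neg).
pose m : 'X_{1..4} := [multinom absz (e i 0%R) | i < 4].
have -> : e = exponent_of m.
  by apply/matrixP => i j; rewrite ord1 mxE mnmE gez0_abs //; apply: (forallP e0 i).
exists (mdeg m).+1 => -[//|k] lek.
by rewrite stable // series_coef_exponent_of.
Qed.
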